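(* For $t\geq0$ let $S_tg(\omega)=g(\omega-t)$ on $B_{\infty,\circ}(\mathbb{U},i)$. The infinitesimal generator $\Gamma$ of $(S_{t})_{t\geq0}$ on $B_{\infty,\circ}(\mathbb{U},i)$ is given by $\Gamma g(\omega)=-g'(\omega)$ with domain $$\mathcal{D}(\Gamma)=\{g\in B_{\infty,\circ}(\mathbb{U},i):g'\in B_{\infty,\circ}(\mathbb{U},i)\}.$$
   Context: $\mathbb{U}=\{\omega\in\mathbb{C}:\Im(\omega)>0\}$ is the upper half plane and $\mathcal{H}(\mathbb{U})$ is the space of analytic functions on $\mathbb{U}$. The little Bloch space is $B_{\infty,\circ}(\mathbb{U})=\{f\in\mathcal{H}(\mathbb{U}):\lim_{\Im(\omega)\to0}\Im(\omega)|f'(\omega)|=0\}$, with the norm of the Bloch space $B_\infty(\mathbb{U})=\{f\in\mathcal H(\mathbb{U}):\sup_{\omega\in\mathbb{U}}\Im(\omega)|f'(\omega)|<\infty\}$, namely $\|f\|_{B_\infty(\mathbb{U})}=|f(i)|+\sup_{\omega\in\mathbb{U}}\Im(\omega)|f'(\omega)|$. Its subspace $B_{\infty,\circ}(\mathbb{U},i)=\{f\in B_{\infty,\circ}(\mathbb{U}):f(i)=0\}$ is equipped with the norm $\|f\|=\sup_{\omega\in\mathbb{U}}\Im(\omega)|f'(\omega)|$. The infinitesimal generator of a semigroup $(S_t)_{t\ge0}$ is $\Gamma g=\lim_{t\to0^+}\frac{S_tg-g}{t}$ (norm limit), with domain $\mathcal{D}(\Gamma)$ the set of $g$ for which the limit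 exists.
   Formalization: Since S_t g need not vanish at i, the limit of (S_t g - g)/t is taken in the Bloch norm |f(i)|+sup Im(ω)|f'(ω)|, with g and the limit in the subspace of functions vanishing at i; the little Bloch space is taken inside the Bloch space (finite sup). *)

(* Defs.v *)
From Stdlib Require Import Reals.
From Coquelicot Require Import Coquelicot.

Open Scope R_scope.

(* Functions on the upper half plane are represented by total functions
   [C -> C].  Only their values on [upper_half_plane] are relevant: it is open,
   so [ex_derive] and [C_derive] at its points depend on nothing else, and
   equality of functions is pointwise equality on [upper_half_plane]. *)
Definition upper_half_plane (w : C) : Prop := 0 < Im w.

Definition analytic (f : C -> C) : Prop :=
  forall w : C, upper_half_plane w ->
    ex_derive (K := C_AbsRing) (V := C_NormedModule) f w.

(* Least upper bounds are taken in [Rbar], so [p_infty] is a possible value. *)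
Definition bloch_seminorm (f : C -> C) : Rbar :=
  Lub_Rbar (fun y : R =>
    exists w : C, upper_half_plane w /\ y = Im w * Cmod (C_derive f w)).

Definition bloch_norm (f : C -> C) : Rbar :=
  Rbar_plus (Cmod (f Ci)) (bloch_seminorm f).

Definition bloch (f : C -> C) : Prop :=
  analytic f /\ Rbar_lt (bloch_seminorm f) p_infty.

(* The limit as [Im w] tends to 0 is uniform in [Re w].  It does not bound
   [Im w * Cmod (C_derive f w)] away from the real line (take [f w = w]), so
   membership in the Bloch space is a separate condition. *)
Definition little_bloch (f : C -> C) : Prop :=
  bloch f /\
  forall eps : R, 0 < eps ->
    exists delta : R, 0 < delta /\
      forall w : C, upper_half_plane w -> Im w < delta ->
        Im w * Cmod (C_derive f w) < eps.

Definition little_bloch_i (f : C -> C) : Prop :=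
  little_bloch f /\ f Ci = RtoC 0.

Definition translation (t : R) (g : C -> C) : C -> C :=
  fun w => g (w - RtoC t)%C.

(* [is_generator X N S g h]: [g] is in the domain of the generator on [X] of the
   family [S], with value [h], limits being taken in the norm [N]. *)
Definition is_generator (X : (C -> C) -> Prop) (N : (C -> C) -> Rbar)
    (S : R -> (C -> C) -> (C -> C)) (g h : C -> C) : Prop :=
  X g /\ X h /\
  forall eps : R, 0 < eps ->
    at_right 0 (fun t : R =>
      Rbar_lt (N (fun w => ((S t g w - g w) / RtoC t - h w)%C)) eps).

Definition in_generator_domain (X : (C -> C) -> Prop) (N : (C -> C) -> Rbar)
    (S : R -> (C -> C) -> (C -> C)) (g : C -> C) : Prop :=
  exists h : C -> C, is_generator X N S g h.

(* Translations do not preserve the condition [f Ci = 0], so the difference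
   quotients lie in the little Bloch space but in general not in its subspace
   [little_bloch_i].  Convergence is therefore measured in the Bloch norm, which
   on [little_bloch_i] is the norm of that subspace, [bloch_seminorm].  On the
   quotients themselves [bloch_seminorm] does not see additive constants. *)
Definition translation_generator (g h : C -> C) : Prop :=
  is_generator little_bloch_i bloch_norm translation g h.

Definition translation_generator_domain (g : C -> C) : Prop :=
  in_generator_domain little_bloch_i bloch_norm translation g.

(* Main.v *)
(* If [g] is in the domain with value [h], the Bloch norm controls the error of
   the difference quotient at [i] and its derivative everywhere; integrating
   from [i] gives pointwise convergence, so [h = - g'].

   Conversely let [G = g'] be in the little Bloch space and [H = G'].  The error
   has derivative [(G (w - t) - G w) / t + H w].  Near the real line both terms
   are small by the mean value inequality.  Away from it one needs
   [|H (w - s) - H w| <= C s / (Im w)^2]; it follows from the Cauchy estimate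
   for the second differences of [g], which are bounded by
   [s u sup (Im w * |H w|) / Im w].  Since [g] has a continuous derivative, the
   Cauchy estimate is obtained by differentiating circle integrals in the
   radius. *)

Require Import Defs.
From Stdlib Require Import Reals.
From Coquelicot Require Import Coquelicot.
From Stdlib Require Import Lra.

(** * Complex derivatives in epsilon-delta form *)

Notation cderiv f w l := (is_derive (K := C_AbsRing) (V := C_NormedModule) f w l).

Lemma cderiv_eps (f : C -> C) (w l : C) :
  cderiv f w l <->
  forall eps, 0 < eps -> exists delta, 0 < delta /\ forall z : C,
    Cmod (z - w) < delta -> Cmod (f z - f w - (z - w) * l) <= eps * Cmod (z - w).
Proof.
split.
- intros [_ H] eps He.
  destruct (H w (fun P HP => HP) (mkposreal eps He)) as [d Hd].
  exists d; split; [apply cond_pos|]. intros z Hz.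
  exact (Hd z Hz).
- intros H. split.
  + apply is_linear_scal_l.
  + intros x Hx eps.
    (* The definition of [is_derive] quantifies over every limit of the neighbourhood filter of [w];
       separation leaves only [w] itself. *)
    assert (Ex : w = x) by exact (is_filter_lim_locally_unique (K := C_AbsRing) (V := AbsRing_NormedModule C_AbsRing) w x Hx).
    subst x.
    destruct (H eps (cond_pos eps)) as [d [Hd Hz]].
    exists (mkposreal d Hd). intros z Bz.
    exact (Hz z Bz).
Qed.

Lemma cderiv_linear (f : C -> C) (w l c : C) :
  cderiv f w l -> cderiv (fun z => c * f z)%C w (c * l)%C.
Proof.
rewrite !cderiv_eps. intros H eps He.
assert (Hc := Cmod_ge_0 c).
(* The added 1 keeps the denominator positive when [c] is 0. *)
assert (He' : 0 < eps / (Cmod c + 1)) by (apply Rdiv_lt_0_compat; lra).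
destruct (H _ He') as [d [Hd Hz]]. exists d; split; auto. intros z Bz.
specialize (Hz z Bz).
replace (c * f z - c * f w - (z - w) * (c * l))%C with (c * (f z - f w - (z - w) * l))%C by ring.
rewrite Cmod_mult.
assert (P := Cmod_ge_0 (z-w)).
apply Rle_trans with ((Cmod c + 1) * (eps / (Cmod c + 1) * Cmod (z - w))).
- apply Rmult_le_compat; auto using Cmod_ge_0; lra.
- right; field; lra.
Qed.

Lemma cderiv_minus (f g : C -> C) (w l m : C) :
  cderiv f w l -> cderiv g w m -> cderiv (fun z => f z - g z)%C w (l - m)%C.
Proof. apply (is_derive_minus (K := C_AbsRing) (V := C_NormedModule)). Qed.

Lemma cderiv_id_scal (w c : C) : cderiv (fun z => z * c)%C w c.
Proof.
apply cderiv_eps. intros eps He. exists 1; split; [lra|]. intros z _.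
replace (z * c - w * c - (z - w) * c)%C with (RtoC 0) by ring.
rewrite Cmod_0. apply Rmult_le_pos; [lra|apply Cmod_ge_0].
Qed.

Lemma cderiv_translation (f : C -> C) (w l : C) (t : R) :
  cderiv f (w - RtoC t)%C l -> cderiv (fun z => f (z - RtoC t))%C w l.
Proof.
rewrite !cderiv_eps. intros H eps He. destruct (H eps He) as [d [Hd Hz]].
exists d; split; auto. intros z Bz.
assert (E : (z - w = (z - t) - (w - t))%C) by ring.
rewrite E. apply Hz. rewrite <- E. exact Bz.
Qed.

Lemma im_le_Cmod (z : C) : Rabs (Im z) <= Cmod z.
Proof. eapply Rle_trans; [|apply Rmax_Cmod]. apply Rmax_r. Qed.

Lemma upper_half_plane_locally (w : C) :
  upper_half_plane w -> locally (T := AbsRing_UniformSpace C_AbsRing) w upper_half_plane.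
Proof.
intros Hw. exists (mkposreal _ Hw). intros z Hz.
assert (Hz' : Cmod (z - w) < Im w) by exact Hz.
revert Hz'. clear Hz. revert z. change (forall z : C, Cmod (z - w) < Im w -> upper_half_plane z).
intros z Hz. assert (A := im_le_Cmod (z - w)).
assert (B : Rabs (Im (z - w)) < Im w) by lra.
unfold upper_half_plane. replace (Im (z - w)) with (Im z - Im w) in B by (destruct z, w; simpl; ring).
apply Rabs_def2 in B. lra.
Qed.

Lemma cderiv_ext_upper (f g : C -> C) (w l : C) :
  upper_half_plane w -> (forall z, upper_half_plane z -> f z = g z) ->
  cderiv f w l -> cderiv g w l.
Proof.
intros Hw Hfg. apply is_derive_ext_loc.
eapply filter_imp; [exact Hfg | apply upper_half_plane_locally; exact Hw].
Qed.

Lemma cderiv_C_derive (f : C -> C) (w : C) :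
  analytic f -> upper_half_plane w -> cderiv f w (C_derive f w).
Proof. intros Hf Hw. apply C_derive_correct; auto. Qed.

(** * Real derivatives along planar paths and the mean value inequality *)

Lemma is_derive_R_eps (f : R -> R) (x l : R) :
  is_derive f x l <->
  forall eps, 0 < eps -> exists delta, 0 < delta /\ forall y,
    Rabs (y - x) < delta -> Rabs (f y - f x - (y - x) * l) <= eps * Rabs (y - x).
Proof.
split.
- intros [_ H] eps He.
  destruct (H x (fun P HP => HP) (mkposreal eps He)) as [d Hd].
  exists d; split; [apply cond_pos|]. intros z Hz. exact (Hd z Hz).
- intros H. split.
  + apply is_linear_scal_l.
  + intros y Hy eps.
    assert (Ex : x = y) by (apply is_filter_lim_locally_unique; exact Hy).
    subst y.
    destruct (H eps (cond_pos eps)) as [d [Hd Hz]].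
    exists (mkposreal d Hd). intros z Bz. exact (Hz z Bz).
Qed.

Lemma Cmod_le_abs (z : C) : Cmod z <= Rabs (Re z) + Rabs (Im z).
Proof.
destruct z as [x y].
replace (x, y) with (RtoC x + RtoC y * Ci)%C
  by (unfold RtoC, Ci, Cplus, Cmult; simpl; f_equal; ring).
eapply Rle_trans; [apply Cmod_triangle|].
rewrite Cmod_mult, Cmod_Ci, !Cmod_R. simpl.
right. rewrite Rmult_1_r. f_equal; f_equal; ring.
Qed.

(** Reduces complex differentiation to real differentiation along a path, so that the real mean
    value theorem and real integrals apply. The error of the composite is the first-order error of
    [f] plus [l] times the error of the path. *)
Lemma is_derive_Re_comp (f : C -> C) (x y : R -> R) (t a b : R) (l : C) :
  cderiv f (x t, y t) l -> is_derive x t a -> is_derive y t b ->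
  is_derive (fun s => Re (f (x s, y s))) t (Re ((a, b) * l)).
Proof.
rewrite cderiv_eps, !is_derive_R_eps. intros Hf Hx Hy eps He.
(* The path moves by at most [L * r]: its tangent contributes [Rabs a + Rabs b], and the two
   coordinate errors contribute at most 2 because [e2 <= 1]. *)
set (L := Rabs a + Rabs b + 2).
assert (Ha := Rabs_pos a). assert (Hb := Rabs_pos b). assert (Hl := Cmod_ge_0 l).
assert (HL : 0 < L) by (unfold L; lra).
assert (He1 : 0 < eps / (2 * L)) by (apply Rdiv_lt_0_compat; lra).
assert (He2 : 0 < Rmin 1 (eps / (4 * (Cmod l + 1)))).
{ apply Rmin_glb_lt; [lra|]. apply Rdiv_lt_0_compat; lra. }
destruct (Hf _ He1) as [d [Hd Hf']].
destruct (Hx _ He2) as [d1 [Hd1 Hx']]. destruct (Hy _ He2) as [d2 [Hd2 Hy']].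
set (e2 := Rmin 1 (eps / (4 * (Cmod l + 1)))) in *.
assert (E1 : e2 <= 1) by apply Rmin_l.
assert (E2 : e2 <= eps / (4 * (Cmod l + 1))) by apply Rmin_r.
assert (E3 : e2 * Cmod l <= eps / 4).
{ apply Rle_trans with (eps / (4 * (Cmod l + 1)) * (Cmod l + 1)).
  - apply Rmult_le_compat; lra.
  - right; field; lra. }
exists (Rmin (d / L) (Rmin d1 d2)); split.
{ repeat apply Rmin_glb_lt; auto. apply Rdiv_lt_0_compat; lra. }
intros s Hs.
assert (S0 : Rabs (s - t) < d / L) by (eapply Rlt_le_trans; [apply Hs|apply Rmin_l]).
assert (S1 : Rabs (s - t) < d1).
{ eapply Rlt_le_trans; [apply Hs|]. eapply Rle_trans; [apply Rmin_r|apply Rmin_l]. }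
assert (S2 : Rabs (s - t) < d2).
{ eapply Rlt_le_trans; [apply Hs|]. eapply Rle_trans; [apply Rmin_r|apply Rmin_r]. }
specialize (Hx' s S1). specialize (Hy' s S2).
set (r := Rabs (s - t)) in *. assert (Hr : 0 <= r) by apply Rabs_pos.
set (dz := ((x s, y s) - (x t, y t))%C).
set (err := (dz - RtoC (s - t) * (a, b))%C).
assert (Herr : Cmod err <= 2 * (e2 * r)).
{ eapply Rle_trans; [apply Cmod_le_abs|].
  replace (Re err) with (x s - x t - (s - t) * a) by (unfold err, dz; simpl; ring).
  replace (Im err) with (y s - y t - (s - t) * b) by (unfold err, dz; simpl; ring).
  lra. }
assert (Hdz : Cmod dz <= L * r).
{ replace dz with (err + RtoC (s - t) * (a, b))%C by (unfold err; ring).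
  eapply Rle_trans; [apply Cmod_triangle|]. rewrite Cmod_mult, Cmod_R.
  assert (A := Cmod_le_abs (a, b)). simpl in A. fold r.
  unfold L. assert (r * Cmod (a, b) <= r * (Rabs a + Rabs b)) by (apply Rmult_le_compat_l; lra).
  nra. }
assert (Bz : Cmod dz < d).
{ eapply Rle_lt_trans; [apply Hdz|].
  replace d with (L * (d / L)) by (field; lra). apply Rmult_lt_compat_l; lra. }
specialize (Hf' (x s, y s) Bz). fold dz in Hf'.
replace (Re (f (x s, y s)) - Re (f (x t, y t)) - (s - t) * Re ((a, b) * l))
  with (Re ((f (x s, y s) - f (x t, y t) - dz * l) + err * l)).
2:{ unfold err. generalize dz; intros [p q]. destruct l as [l1 l2], (f (x s, y s)), (f (x t, y t)).
    simpl. ring. }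
eapply Rle_trans; [apply re_le_Cmod|]. eapply Rle_trans; [apply Cmod_triangle|].
rewrite Cmod_mult.
assert (eps / (2 * L) * Cmod dz <= eps / 2 * r).
{ apply Rle_trans with (eps / (2 * L) * (L * r)).
  - apply Rmult_le_compat_l; lra.
  - right; field; lra. }
assert (Cmod err * Cmod l <= 2 * (e2 * r) * Cmod l) by (apply Rmult_le_compat_r; lra).
assert (r * (e2 * Cmod l) <= r * (eps / 4)) by (apply Rmult_le_compat_l; lra).
lra.
Qed.

(** Multiplication by [- Ci] turns the imaginary part into a real part. *)
Lemma is_derive_Im_comp (f : C -> C) (x y : R -> R) (t a b : R) (l : C) :
  cderiv f (x t, y t) l -> is_derive x t a -> is_derive y t b ->
  is_derive (fun s => Im (f (x s, y s))) t (Im ((a, b) * l)).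
Proof.
intros Hf Hx Hy.
assert (H := is_derive_Re_comp _ x y t a b _ (cderiv_linear _ _ _ (- Ci)%C Hf) Hx Hy).
replace (Im ((a, b) * l)) with (Re ((a, b) * (- Ci * l))) by (destruct l; simpl; ring).
revert H. apply is_derive_ext. intros s. destruct (f (x s, y s)); simpl; ring.
Qed.

(** Lets a bound on a modulus be deduced from a bound on a real part, both for the mean value
    inequality and for the Cauchy estimate. *)
Lemma exists_rotation_to_Cmod (z : C) : exists c, Cmod c = 1 /\ (c * z)%C = RtoC (Cmod z).
Proof.
destruct (Req_dec (Cmod z) 0) as [H|H].
- exists 1%C; split; [apply Cmod_1|]. rewrite H. rewrite (Cmod_eq_0 _ H). ring.
- assert (Hz : RtoC (Cmod z) <> 0%C) by (intros E; apply H; now injection E).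
  exists (Cconj z / RtoC (Cmod z))%C; split.
  + rewrite Cmod_div; auto. rewrite Cmod_conj, Cmod_R, Rabs_pos_eq by apply Cmod_ge_0. field; auto.
  + assert (E := Cmod2_conj z).
    replace (Cconj z / Cmod z * z)%C with ((z * Cconj z) / Cmod z)%C by (field; auto).
    rewrite <- E, RtoC_pow. field; auto.
Qed.

(** The mean value theorem fails for complex values, so the increment is first rotated onto the
    nonnegative real axis; the real theorem is then applied to the real part along the segment. *)
Lemma mean_value_inequality (f f' : C -> C) (a b : C) (M : R) :
  (forall s, 0 <= s <= 1 -> cderiv f (a + RtoC s * (b - a))%C (f' (a + RtoC s * (b - a))%C)
     /\ Cmod (f' (a + RtoC s * (b - a))%C) <= M) ->
  Cmod (f b - f a) <= M * Cmod (b - a).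
Proof.
intros H. destruct (exists_rotation_to_Cmod (f b - f a)) as [c [Hc Ec]].
set (x := fun s => Re a + s * Re (b - a)). set (y := fun s => Im a + s * Im (b - a)).
assert (Exy : forall s, (a + RtoC s * (b - a))%C = (x s, y s)).
{ intros s. unfold x, y. destruct a, b. unfold Cplus, Cmult, Cminus, RtoC; simpl. f_equal; ring. }
assert (D : forall s, 0 <= s <= 1 ->
  is_derive (fun s => Re (c * f (x s, y s))%C) s (Re ((Re (b - a), Im (b - a)) * (c * f' (x s, y s))))).
{ intros s Hs. apply (is_derive_Re_comp (fun z => c * f z)%C).
  - apply cderiv_linear. rewrite <- Exy. apply H; auto.
  - unfold x. auto_derive; auto. simpl; ring.
  - unfold y. auto_derive; auto. simpl; ring. }
destruct (MVT_gen (fun s => Re (c * f (x s, y s))%C) 0 1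
  (fun s => Re ((Re (b - a), Im (b - a)) * (c * f' (x s, y s))))) as [s [Hs Es]].
- rewrite Rmin_left, Rmax_right by lra. intros; apply D; lra.
- rewrite Rmin_left, Rmax_right by lra. intros s Hs.
  apply continuity_pt_filterlim, (ex_derive_continuous (K:=R_AbsRing) (V:=R_NormedModule)).
  eexists; apply D; auto.
- rewrite Rmin_left, Rmax_right in Hs by lra.
  assert (E1 : (x 1, y 1) = b) by (refine (eq_trans (eq_sym (Exy 1)) _); ring).
  assert (E0 : (x 0, y 0) = a) by (refine (eq_trans (eq_sym (Exy 0)) _); ring).
  assert (E : Re (c * f (x 1, y 1)) - Re (c * f (x 0, y 0)) = Cmod (f b - f a)).
  { rewrite E1, E0. replace (Cmod (f b - f a)) with (Re (c * (f b - f a))).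
    - destruct (f a), (f b), c; simpl; ring.
    - rewrite Ec. reflexivity. }
  rewrite <- E, Es, Rminus_0_r, Rmult_1_r.
  eapply Rle_trans; [apply Rle_abs|]. eapply Rle_trans; [apply re_le_Cmod|].
  rewrite !Cmod_mult, Hc, Rmult_1_l.
  replace (Re (b - a), Im (b - a)) with (b - a)%C by (destruct (b - a)%C; reflexivity).
  rewrite Rmult_comm. apply Rmult_le_compat_r; [apply Cmod_ge_0|].
  rewrite <- Exy. apply H; auto.
Qed.

(** * The Cauchy estimate *)

Definition polar (w : C) (r th : R) : C := (Re w + r * cos th, Im w + r * sin th).

Lemma polar_upper (w : C) (r th : R) :
  Rabs r < Im w -> upper_half_plane (polar w r th).
Proof.
intros H. unfold upper_half_plane, polar; simpl.
assert (S : Rabs (r * sin th) <= Rabs r).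
{ rewrite Rabs_mult. rewrite <- (Rmult_1_r (Rabs r)) at 2.
  apply Rmult_le_compat_l; [apply Rabs_pos|]. apply Rabs_le, SIN_bound. }
assert (Rabs (r * sin th) < Im w) by lra. apply Rabs_def2 in H0. lra.
Qed.

Lemma Cmod_polar (w : C) (r th : R) : 0 <= r -> Cmod (polar w r th - w) = r.
Proof.
intros Hr. unfold polar, Cmod. destruct w as [a b]. simpl.
assert (A := sin2_cos2 th). unfold Rsqr in A.
transitivity (sqrt (Rsqr r)); [f_equal; unfold Rsqr|apply sqrt_Rsqr, Hr].
transitivity (r * r * (sin th * sin th + cos th * cos th)); [ring|rewrite A; ring].
Qed.

Section CircleMean.

Variables (k k' : C -> C) (w : C).
Hypothesis Hk : forall z, upper_half_plane z -> cderiv k z (k' z).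
Hypothesis Hk' : forall z, upper_half_plane z -> exists l, cderiv k' z l.

(* [u] and [v] are the real and imaginary parts of [exp (- i th) k], so that the
   radial derivative of [u] is [d] and the angular one of [v] is [r d - u]. *)
Let u r th := Re (k (polar w r th)) * cos th + Im (k (polar w r th)) * sin th.
Let v r th := Im (k (polar w r th)) * cos th - Re (k (polar w r th)) * sin th.
Let d r th := Re (k' (polar w r th)).

(** The radial velocity is [exp (i th)], which the factor [exp (- i th)] in [u] cancels, leaving the
    real part of [k']. *)
Lemma radial_derivative (r th : R) :
  Rabs r < Im w -> is_derive (fun s => u s th) r (d r th).
Proof.
intros H. assert (HP := Hk _ (polar_upper w r th H)).
assert (X : is_derive (fun s => Re w + s * cos th) r (cos th)) by (auto_derive; auto; ring).
assert (Y : is_derive (fun s => Im w + s * sin th) r (sin th)) by (auto_derive; auto; ring).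
assert (A := is_derive_Re_comp k _ _ r _ _ _ HP X Y).
assert (B := is_derive_Im_comp k _ _ r _ _ _ HP X Y).
apply (is_derive_scal_l (K := R_AbsRing) (V := R_NormedModule) _ _ _ (cos th)) in A.
apply (is_derive_scal_l (K := R_AbsRing) (V := R_NormedModule) _ _ _ (sin th)) in B.
assert (E := is_derive_plus _ _ _ _ _ A B).
replace (d r th) with (plus (scal (Re ((cos th, sin th) * k' (polar w r th))) (cos th))
  (scal (Im ((cos th, sin th) * k' (polar w r th))) (sin th))); [exact E|].
unfold plus, scal, d; simpl. unfold mult; simpl.
assert (S := sin2_cos2 th). unfold Rsqr in S.
destruct (k' (polar w r th)) as [p q]; simpl.
replace p with (p * (sin th * sin th + cos th * cos th)) at 3 by (rewrite S; ring). ring.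
Qed.

Lemma polar_comp_angular (f : C -> C) (r th : R) (l : C) : cderiv f (polar w r th) l ->
  is_derive (fun s => Re (f (polar w r s))) th (Re ((- r * sin th, r * cos th) * l)) /\
  is_derive (fun s => Im (f (polar w r s))) th (Im ((- r * sin th, r * cos th) * l)).
Proof.
intros H.
assert (X : is_derive (fun s => Re w + r * cos s) th (- r * sin th)) by (auto_derive; auto; ring).
assert (Y : is_derive (fun s => Im w + r * sin s) th (r * cos th)) by (auto_derive; auto; ring).
split.
- exact (is_derive_Re_comp f _ _ th _ _ _ H X Y).
- exact (is_derive_Im_comp f _ _ th _ _ _ H X Y).
Qed.

(** The angular velocity [i r exp (i th)] is cancelled up to [i r], and the imaginary part of
    [i r k'] is [r d]. Differentiating the factor [exp (- i th)] contributes [- u]. *)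
Lemma angular_derivative (r th : R) :
  Rabs r < Im w -> is_derive (fun s => v r s) th (r * d r th - u r th).
Proof.
intros H. destruct (polar_comp_angular k r th _ (Hk _ (polar_upper w r th H))) as [A B].
assert (C := is_derive_cos th). assert (S := is_derive_sin th).
assert (E := is_derive_minus _ _ _ _ _
  (is_derive_mult _ _ _ _ _ B C Rmult_comm) (is_derive_mult _ _ _ _ _ A S Rmult_comm)).
unfold minus, plus, opp, mult in E; simpl in E.
match type of E with is_derive _ _ ?l => replace (r * d r th - u r th) with l; [exact E|] end.
unfold d, u. assert (T := sin2_cos2 th). unfold Rsqr in T.
destruct (k' (polar w r th)) as [p q]; simpl.
transitivity (r * (p * (sin th * sin th + cos th * cos th)) -
  (fst (k (polar w r th)) * cos th + snd (k (polar w r th)) * sin th)); [unfold Re, Im; ring|].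
rewrite T. unfold Re, Im. ring.
Qed.

Lemma ex_derive_angular_u (r th : R) : Rabs r < Im w -> ex_derive (fun s => u r s) th.
Proof.
intros H. destruct (polar_comp_angular k r th _ (Hk _ (polar_upper w r th H))) as [A B].
assert (C := is_derive_cos th). assert (S := is_derive_sin th).
eexists. exact (is_derive_plus _ _ _ _ _
  (is_derive_mult _ _ _ _ _ A C Rmult_comm) (is_derive_mult _ _ _ _ _ B S Rmult_comm)).
Qed.

Lemma ex_derive_angular_d (r th : R) : Rabs r < Im w -> ex_derive (fun s => d r s) th.
Proof.
intros H. destruct (Hk' _ (polar_upper w r th H)) as [l Hl].
destruct (polar_comp_angular k' r th _ Hl) as [A B]. eexists; exact A.
Qed.

(** Joint continuity is what differentiation under the integral sign requires. It holds because [k']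
    is itself differentiable. *)
Lemma continuity_2d_d (r th : R) : Rabs r < Im w -> continuity_2d_pt d r th.
Proof.
intros H. destruct (Hk' _ (polar_upper w r th H)) as [l Hl].
assert (X : continuity_2d_pt (fun r th => Re w + r * cos th) r th).
{ apply continuity_2d_pt_plus; [apply continuity_2d_pt_const|].
  apply continuity_2d_pt_mult; [apply continuity_2d_pt_id1|].
  apply (continuity_1d_2d_pt_comp cos); [apply continuity_cos|apply continuity_2d_pt_id2]. }
assert (Y : continuity_2d_pt (fun r th => Im w + r * sin th) r th).
{ apply continuity_2d_pt_plus; [apply continuity_2d_pt_const|].
  apply continuity_2d_pt_mult; [apply continuity_2d_pt_id1|].
  apply (continuity_1d_2d_pt_comp sin); [apply continuity_sin|apply continuity_2d_pt_id2]. }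
intros eps. rewrite cderiv_eps in Hl.
(* With tolerance 1, increments of [k'] from this point are at most [Cmod l + 1] times the
   distance. *)
destruct (Hl 1 Rlt_0_1) as [d0 [Hd0 Hz]].
assert (Pl := Cmod_ge_0 l).
assert (Hm : 0 < Rmin (d0 / 2) (eps / (4 * (Cmod l + 1)))).
{ apply Rmin_glb_lt; [lra|]. apply Rdiv_lt_0_compat; [apply cond_pos|lra]. }
assert (M1 := Rmin_l (d0 / 2) (eps / (4 * (Cmod l + 1)))).
assert (M2 := Rmin_r (d0 / 2) (eps / (4 * (Cmod l + 1)))).
set (m := Rmin _ _) in *.
apply (locally_2d_impl _ _ _ _) with (2 := locally_2d_and _ _ _ _ (X (mkposreal _ Hm)) (Y (mkposreal _ Hm))).
apply locally_2d_forall. simpl. intros r' th' [Xr Yr]. unfold d.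
fold (polar w r' th').
assert (Hdz : Cmod (polar w r' th' - polar w r th) < 2 * m).
{ eapply Rle_lt_trans; [apply Cmod_le_abs|]. unfold polar; simpl. unfold Rminus in Xr, Yr.
  change (fst w) with (Re w); change (snd w) with (Im w). lra. }
specialize (Hz (polar w r' th')).
assert (Hz' := Hz ltac:(lra)). clear Hz.
set (dz := (polar w r' th' - polar w r th)%C) in *.
replace (Re (k' (polar w r' th')) - Re (k' (polar w r th))) with
  (Re ((k' (polar w r' th') - k' (polar w r th) - dz * l) + dz * l)).
2:{ generalize (dz * l)%C; intros [p q]. destruct (k' (polar w r' th')), (k' (polar w r th)); simpl; ring. }
eapply Rle_lt_trans; [apply re_le_Cmod|]. eapply Rle_lt_trans; [apply Cmod_triangle|].
rewrite Cmod_mult.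
apply Rle_lt_trans with ((Cmod l + 1) * Cmod dz); [lra|].
apply Rlt_le_trans with ((Cmod l + 1) * (2 * m)); [apply Rmult_lt_compat_l; lra|].
apply Rle_trans with ((Cmod l + 1) * (2 * (eps / (4 * (Cmod l + 1))))).
- apply Rmult_le_compat_l; lra.
- assert (He := cond_pos eps). replace (_ * _) with (eps / 2) by (field; lra). lra.
Qed.
Let Phi (r : R) : R := RInt (u r) 0 (2 * PI).

Lemma ex_RInt_u (r : R) : Rabs r < Im w -> ex_RInt (u r) 0 (2 * PI).
Proof.
intros H. apply (ex_RInt_continuous (V := R_CompleteNormedModule)). intros th _.
apply (ex_derive_continuous (K := R_AbsRing) (V := R_NormedModule)), ex_derive_angular_u, H.
Qed.

Lemma ex_RInt_d (r : R) : Rabs r < Im w -> ex_RInt (d r) 0 (2 * PI).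
Proof.
intros H. apply (ex_RInt_continuous (V := R_CompleteNormedModule)). intros th _.
apply (ex_derive_continuous (K := R_AbsRing) (V := R_NormedModule)), ex_derive_angular_d, H.
Qed.

(** [v r] takes the same value at 0 and [2 * PI], so the integral of its derivative [r d - u]
    vanishes. *)
Lemma circle_mean_identity (r : R) : Rabs r < Im w -> r * RInt (d r) 0 (2 * PI) = Phi r.
Proof.
intros H.
assert (I := is_RInt_derive (V := R_CompleteNormedModule) (v r) (fun th => r * d r th - u r th) 0 (2 * PI)
  (fun th _ => angular_derivative r th H)).
assert (C : forall th, continuous (fun th => r * d r th - u r th) th).
{ intros th. apply (ex_derive_continuous (K := R_AbsRing) (V := R_NormedModule)).
  apply (ex_derive_minus (K := R_AbsRing) (V := R_NormedModule)).
  - apply ex_derive_scal, ex_derive_angular_d, H.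
  - apply ex_derive_angular_u, H. }
specialize (I (fun th _ => C th)). apply is_RInt_unique in I.
assert (J := is_RInt_minus (V := R_NormedModule) _ _ _ _ _ _
  (is_RInt_scal (V := R_NormedModule) _ _ _ r _ (RInt_correct (V := R_CompleteNormedModule) _ _ _ (ex_RInt_d r H)))
  (RInt_correct (V := R_CompleteNormedModule) _ _ _ (ex_RInt_u r H))).
apply (is_RInt_unique (V := R_CompleteNormedModule)) in J.
unfold minus, plus, opp, scal in I, J; simpl in I, J; unfold mult in I, J; simpl in I, J.
assert (V0 : v r (2 * PI) = v r 0).
{ unfold v, polar. rewrite sin_2PI, cos_2PI, sin_0, cos_0. reflexivity. }
rewrite V0 in I. unfold Phi.
assert (E : r * RInt (d r) 0 (2 * PI) + - RInt (u r) 0 (2 * PI) = v r 0 + - v r 0).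
{ rewrite <- I. symmetry. exact J. }
lra.
Qed.

(** Differentiation under the integral sign; the radial derivative is known only while the circle
    stays in the half plane, hence the neighbourhood [N] of [r]. *)
Lemma is_derive_circle_integral (r : R) : Rabs r < Im w -> is_derive Phi r (RInt (d r) 0 (2 * PI)).
Proof.
intros H.
assert (N : locally r (fun s => Rabs s < Im w)).
{ assert (Hp : 0 < Im w - Rabs r) by lra.
  exists (mkposreal _ Hp). change (forall s : R, Rabs (s - r) < Im w - Rabs r -> Rabs s < Im w). intros s Hs.
  assert (T := Rabs_triang (s - r) r). replace (s - r + r) with s in T by ring. lra. }
assert (D := is_derive_RInt_param u 0 (2 * PI) r).
assert (E : RInt (fun t => Derive (fun s => u s t) r) 0 (2 * PI) = RInt (d r) 0 (2 * PI)).
{ apply RInt_ext. intros t _. apply is_derive_unique, radial_derivative, H. }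
rewrite E in D. apply D; clear D E.
- eapply filter_imp; [|exact N]. intros s Hs t _. eexists. apply radial_derivative, Hs.
- intros t _. apply (continuity_2d_pt_ext_loc d); [|apply continuity_2d_d, H].
  destruct N as [e He]. exists e. intros s th Hs _.
  symmetry. apply is_derive_unique, radial_derivative, He, Hs.
- eapply filter_imp; [|exact N]. intros s Hs. apply ex_RInt_u, Hs.
Qed.

(* The derivative [Phi' r] is [Phi r / r], so that [Phi r / r] is constant; its limit at 0 is [Phi' 0]. *)
Lemma circle_integral_linear (r : R) : 0 < r < Im w -> Phi r = r * (2 * PI * Re (k' w)).
Proof.
intros Hr.
assert (P0 : RInt (d 0) 0 (2 * PI) = 2 * PI * Re (k' w)).
{ rewrite (RInt_ext _ (fun _ => Re (k' w))).
  - rewrite RInt_const. unfold scal; simpl. unfold mult; simpl. ring.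
  - intros th _. unfold d, polar. rewrite !Rmult_0_l, !Rplus_0_r. destruct w; reflexivity. }
(* Radii are signed, so 0 is an interior point and [Phi] has an ordinary derivative there. *)
assert (A0 : Rabs 0 < Im w) by (rewrite Rabs_R0; lra).
assert (Z : Phi 0 = 0) by (rewrite <- circle_mean_identity by exact A0; ring).
assert (Q : forall s, 0 < s < r -> Phi r / r = Phi s / s).
{ intros s Hs.
  assert (D : forall x, s <= x <= r -> is_derive (fun x => Phi x / x) x 0).
  { intros x Hx. assert (Ax : Rabs x < Im w) by (rewrite Rabs_pos_eq; lra).
    assert (DP := is_derive_circle_integral x Ax). assert (I := circle_mean_identity x Ax).
    assert (DD := is_derive_div _ _ _ _ _ DP (is_derive_id x) ltac:(unfold id; lra)).
    rewrite <- I in DD. unfold one in DD; simpl in DD. unfold id in DD.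
    match type of DD with is_derive _ _ ?l => replace 0 with l; [exact DD|] end.
    field; lra. }
  destruct (MVT_gen (fun x => Phi x / x) s r (fun _ => 0)) as [c [_ Ec]].
  - rewrite Rmin_left, Rmax_right by lra. intros; apply D; lra.
  - rewrite Rmin_left, Rmax_right by lra. intros x Hx.
    apply continuity_pt_filterlim, (ex_derive_continuous (K:=R_AbsRing) (V:=R_NormedModule) (fun x => Phi x / x)).
    eexists; apply D; auto.
  - lra. }
assert (D0 := is_derive_circle_integral 0 A0). rewrite P0 in D0. rewrite is_derive_R_eps in D0.
set (L := 2 * PI * Re (k' w)) in *.
assert (E : Phi r / r = L).
{ apply Rminus_diag_uniq. apply Rabs_eq_0. apply Rle_antisym; [|apply Rabs_pos].
  apply le_epsilon. intros eps He. destruct (D0 eps He) as [e [Hep Hs]].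
  (* The radius [s] is below [e], where the estimate from the derivative at 0 applies, and below
     [r], where [Q] applies. *)
  assert (M1 := Rmin_l (e / 2) (r / 2)). assert (M2 := Rmin_r (e / 2) (r / 2)).
  assert (M3 : 0 < Rmin (e / 2) (r / 2)) by (apply Rmin_glb_lt; lra).
  set (s := Rmin _ _) in *.
  rewrite (Q s) by lra. specialize (Hs s). rewrite Z, !Rminus_0_r in Hs.
  rewrite (Rabs_pos_eq s) in Hs by lra. specialize (Hs ltac:(lra)).
  replace (Phi s / s - L) with ((Phi s - s * L) / s) by (field; lra).
  rewrite Rabs_div, (Rabs_pos_eq s) by lra. rewrite Rplus_0_l.
  apply Rmult_le_reg_r with s; [lra|]. unfold Rdiv. rewrite Rmult_assoc, Rinv_l by lra. lra. }
rewrite <- E. field. lra.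
Qed.

(** [Phi r] equals [2 * PI * r * Re (k' w)], while its integrand is at most [M] in absolute
    value. *)
Lemma Re_cauchy_estimate (r M : R) :
  0 < r < Im w -> (forall z, Cmod (z - w) = r -> Cmod (k z) <= M) -> r * Re (k' w) <= M.
Proof.
intros Hr HM.
assert (Ar : Rabs r < Im w) by (rewrite Rabs_pos_eq; lra).
assert (B : Rabs (Phi r) <= (2 * PI - 0) * M).
{ assert (HPI := PI_RGT_0). apply abs_RInt_le_const; [lra|apply ex_RInt_u, Ar|].
  intros th _.
  (* Since [u] is the real part of [k] times a number of modulus 1, it is bounded by the modulus of
     [k]. *)
  replace (u r th) with (Re (k (polar w r th) * (cos th, - sin th))).
  2:{ unfold u. destruct (k (polar w r th)); simpl; ring. }
  eapply Rle_trans; [apply re_le_Cmod|]. rewrite Cmod_mult.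
  replace (Cmod (cos th, - sin th)) with 1.
  - rewrite Rmult_1_r. apply HM, Cmod_polar. lra.
  - unfold Cmod; simpl. assert (A := sin2_cos2 th). unfold Rsqr in A.
    replace (cos th * (cos th * 1) + - sin th * (- sin th * 1)) with 1 by lra.
    symmetry; apply sqrt_1. }
rewrite circle_integral_linear in B by exact Hr.
assert (HPI := PI_RGT_0).
assert (B' := Rle_trans _ _ _ (Rle_abs _) B).
apply Rmult_le_reg_l with (2 * PI); [lra|]. lra.
Qed.

End CircleMean.

(** A constant rotation of [k] makes [k' w] real and nonnegative without changing the bound on the
    circle. *)
Lemma cauchy_estimate (k k' : C -> C) (w : C) (r M : R) :
  (forall z, upper_half_plane z -> cderiv k z (k' z)) ->
  (forall z, upper_half_plane z -> exists l, cderiv k' z l) ->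
  0 < r < Im w -> (forall z, Cmod (z - w) = r -> Cmod (k z) <= M) ->
  r * Cmod (k' w) <= M.
Proof.
intros Hk Hk' Hr HM. destruct (exists_rotation_to_Cmod (k' w)) as [c [Hc Ec]].
replace (Cmod (k' w)) with (Re (c * k' w)) by (rewrite Ec; reflexivity).
apply (Re_cauchy_estimate (fun z => c * k z)%C (fun z => c * k' z)%C); auto.
- intros z Hz. apply cderiv_linear; auto.
- intros z Hz. destruct (Hk' z Hz) as [l Hl]. exists (c * l)%C. apply cderiv_linear; auto.
- intros z Hz. rewrite Cmod_mult, Hc, Rmult_1_l. auto.
Qed.

(** * Translations of Bloch functions *)

Lemma Cmod_minus_triangle (a b : C) : Cmod (a - b) <= Cmod a + Cmod b.
Proof. eapply Rle_trans; [apply Cmod_triangle|]. rewrite Cmod_opp. lra. Qed.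

Lemma Im_translate (w : C) (t : R) : Im (w - RtoC t) = Im w.
Proof. destruct w; simpl; ring. Qed.

Lemma upper_translate (w : C) (t : R) : upper_half_plane w -> upper_half_plane (w - RtoC t)%C.
Proof. unfold upper_half_plane. rewrite Im_translate. auto. Qed.

Lemma RtoC_neq_0 (t : R) : t <> 0 -> RtoC t <> 0%C.
Proof. intros H E. apply H. now injection E. Qed.

(** Height is constant along a translation, so a Bloch bound becomes a single constant [M] on the
    whole segment. *)
Lemma horizontal_increment (f f' : C -> C) (w : C) (t M : R) :
  0 <= t ->
  (forall s, 0 <= s <= t -> cderiv f (w - RtoC s)%C (f' (w - RtoC s)%C)
     /\ Cmod (f' (w - RtoC s)%C) <= M) ->
  Cmod (f (w - RtoC t)%C - f w) <= M * t.
Proof.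
intros Ht H.
replace t with (Cmod (w - RtoC t - w)) at 2.
- apply (mean_value_inequality f f'). intros s Hs.
  replace (w + RtoC s * (w - RtoC t - w))%C with (w - RtoC (s * t))%C
    by (rewrite RtoC_mult; ring).
  apply H. nra.
- replace (w - RtoC t - w)%C with (- RtoC t)%C by ring.
  rewrite Cmod_opp, Cmod_R. apply Rabs_pos_eq, Ht.
Qed.

(** * Difference quotients when the derivative [G] of [g] is a Bloch function *)

Section BlochDerivative.

Variables (g G H : C -> C) (M : R).
Hypothesis Hg : forall z, upper_half_plane z -> cderiv g z (G z).
Hypothesis HG : forall z, upper_half_plane z -> cderiv G z (H z).
Hypothesis HH : forall z, upper_half_plane z -> Im z * Cmod (H z) <= M.

Lemma horizontal_increment_derivative (w : C) (t : R) : upper_half_plane w -> 0 <= t ->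
  Cmod (G (w - RtoC t)%C - G w) <= M / Im w * t.
Proof.
intros Hw Ht. assert (Hw' : 0 < Im w) by exact Hw.
apply (horizontal_increment G H); auto. intros s _.
assert (U := upper_translate w s Hw). split; [auto|].
assert (B := HH _ U). rewrite Im_translate in B.
apply Rmult_le_reg_l with (Im w); [lra|]. replace (Im w * (M / Im w)) with M by (field; lra). exact B.
Qed.

(** The second difference is a horizontal increment, by [s], of the first difference with step [u];
    the derivative of the latter is controlled by [horizontal_increment_derivative]. *)
Lemma second_difference_bound (w : C) (s u : R) : upper_half_plane w -> 0 <= s -> 0 <= u ->
  Cmod ((g (w - RtoC s - RtoC u)%C - g (w - RtoC s)%C) - (g (w - RtoC u)%C - g w)) <= M / Im w * u * s.
Proof.
intros Hw Hs Hu.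
apply (horizontal_increment (fun z => g (z - RtoC u) - g z)%C (fun z => G (z - RtoC u) - G z)%C w s); auto.
intros t _. assert (U := upper_translate w t Hw). split.
- apply cderiv_minus; [apply cderiv_translation|]; apply Hg; auto using upper_translate.
- rewrite <- (Im_translate w t). apply horizontal_increment_derivative; auto.
Qed.

(* The Cauchy estimate on the circle of radius [Im w / 2], where the previous bound at most doubles. *)
Lemma second_difference_derivative_bound (w : C) (s u : R) : upper_half_plane w -> 0 <= s -> 0 <= u ->
  Cmod ((G (w - RtoC s - RtoC u)%C - G (w - RtoC s)%C) - (G (w - RtoC u)%C - G w))
    <= 4 * M / (Im w * Im w) * u * s.
Proof.
intros Hw Hs Hu. assert (Hw' : 0 < Im w) by exact Hw.
assert (HM : 0 <= M).
{ eapply Rle_trans; [|apply (HH _ Hw)]. apply Rmult_le_pos; [lra|apply Cmod_ge_0]. }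
assert (E := cauchy_estimate
  (fun w => (g (w - RtoC s - RtoC u) - g (w - RtoC s)) - (g (w - RtoC u) - g w))%C
  (fun w => (G (w - RtoC s - RtoC u) - G (w - RtoC s)) - (G (w - RtoC u) - G w))%C
  w (Im w / 2) (M / (Im w / 2) * u * s)).
cbv beta in E.
apply Rmult_le_reg_l with (Im w / 2); [lra|].
(* The factor 4 combines a 2 from dividing by the radius with a 2 from the halved height on the
   circle. *)
replace (Im w / 2 * (4 * M / (Im w * Im w) * u * s)) with (M / (Im w / 2) * u * s) by (field; lra).
apply E; clear E.
- intros z Hz. repeat apply cderiv_minus; auto.
  + apply (cderiv_translation (fun z => g (z - RtoC u)%C)), cderiv_translation. auto using upper_translate.
  + apply cderiv_translation. auto using upper_translate.
  + apply cderiv_translation. auto using upper_translate.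
- intros z Hz. eexists. apply cderiv_minus; apply cderiv_minus.
  + apply (cderiv_translation (fun z => G (z - RtoC u)%C)), cderiv_translation. auto using upper_translate.
  + apply cderiv_translation. auto using upper_translate.
  + apply cderiv_translation. auto using upper_translate.
  + apply HG, Hz.
- lra.
- intros z Hz.
  assert (B := im_le_Cmod (z - w)). rewrite Hz in B.
  replace (Im (z - w)) with (Im z - Im w) in B by (destruct z, w; simpl; ring).
  assert (Hz' : Im w / 2 <= Im z).
  { assert (- (Im z - Im w) <= Im w / 2) by (eapply Rle_trans; [apply Rle_abs|rewrite Rabs_Ropp; exact B]). lra. }
  eapply Rle_trans; [apply second_difference_bound; auto; unfold upper_half_plane; lra|].
  repeat apply Rmult_le_compat_r; auto.
  apply Rmult_le_compat_l; auto. apply Rinv_le_contravar; lra.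
Qed.

(** Dividing the second difference of [G] by [u] and letting [u] tend to 0 gives [H w - H (w - s)],
    and the bound is linear in [u]. *)
Lemma horizontal_increment_second_derivative (w : C) (s : R) : upper_half_plane w -> 0 <= s ->
  Cmod (H (w - RtoC s)%C - H w) <= 4 * M / (Im w * Im w) * s.
Proof.
intros Hw Hs. apply le_epsilon. intros eps He.
assert (He2 : 0 < eps / 2) by lra.
assert (D1 := HG _ Hw). assert (D2 := HG _ (upper_translate w s Hw)).
rewrite cderiv_eps in D1, D2.
destruct (D1 _ He2) as [d1 [Hd1 E1]]. destruct (D2 _ He2) as [d2 [Hd2 E2]].
set (u := Rmin d1 d2 / 2).
assert (M1 := Rmin_l d1 d2). assert (M2 := Rmin_r d1 d2).
assert (M3 : 0 < Rmin d1 d2) by (apply Rmin_glb_lt; lra).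
assert (Hu : 0 < u < d1 /\ u < d2) by (unfold u; lra).
specialize (E1 (w - RtoC u)%C). specialize (E2 (w - RtoC s - RtoC u)%C).
replace (w - RtoC u - w)%C with (- RtoC u)%C in E1 by ring.
replace (w - RtoC s - RtoC u - (w - RtoC s))%C with (- RtoC u)%C in E2 by ring.
rewrite Cmod_opp, Cmod_R, Rabs_pos_eq in E1, E2 by lra.
specialize (E1 ltac:(lra)). specialize (E2 ltac:(lra)).
assert (E3 := second_difference_derivative_bound w s u Hw Hs ltac:(lra)).
set (a := G (w - RtoC s - RtoC u)%C) in *. set (b := G (w - RtoC s)%C) in *.
set (c := G (w - RtoC u)%C) in *. set (e := G w) in *.
apply Rmult_le_reg_l with u; [lra|].
replace (u * Cmod (H (w - s) - H w)) with (Cmod (RtoC u * (H (w - s) - H w)))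
  by (rewrite Cmod_mult, Cmod_R, Rabs_pos_eq by lra; reflexivity).
replace (RtoC u * (H (w - s) - H w))%C with
 (((a - b - - RtoC u * H (w - RtoC s)) - (c - e - - RtoC u * H w)) - ((a - b) - (c - e)))%C by ring.
eapply Rle_trans; [apply Cmod_minus_triangle|].
eapply Rle_trans; [apply Rplus_le_compat; [apply Cmod_minus_triangle|apply E3]|].
lra.
Qed.

(** Subtracting the linear function [z * H w] from [G] makes the error, multiplied by [t], an
    increment of a function whose derivative [H z - H w] is small on the segment. *)
Lemma difference_quotient_derivative (w : C) (t : R) : upper_half_plane w -> 0 < t ->
  Cmod ((G (w - RtoC t)%C - G w) / RtoC t + H w) <= 4 * M / (Im w * Im w) * t.
Proof.
intros Hw Ht. assert (Hw' : 0 < Im w) by exact Hw.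
assert (HM : 0 <= M).
{ eapply Rle_trans; [|apply (HH _ Hw)]. apply Rmult_le_pos; [lra|apply Cmod_ge_0]. }
assert (E : Cmod ((G (w - RtoC t) - (w - RtoC t) * H w) - (G w - w * H w))%C
   <= 4 * M / (Im w * Im w) * t * t).
{ apply (horizontal_increment (fun z => G z - z * H w)%C (fun z => H z - H w)%C); [lra|].
  intros s Hs. split.
  - apply cderiv_minus; [apply HG, upper_translate, Hw|apply cderiv_id_scal].
  - eapply Rle_trans; [apply horizontal_increment_second_derivative; auto; lra|].
    apply Rmult_le_compat_l; [|lra].
    apply Rmult_le_pos; [lra|]. left. apply Rinv_0_lt_compat. nra. }
assert (Nt := RtoC_neq_0 t ltac:(lra)).
replace ((G (w - RtoC t)%C - G w) / RtoC t + H w)%C with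
  (((G (w - RtoC t) - (w - RtoC t) * H w) - (G w - w * H w)) / RtoC t)%C by (field; auto).
rewrite Cmod_div, Cmod_R, Rabs_pos_eq by (auto; lra).
apply Rmult_le_reg_r with t; [lra|]. unfold Rdiv at 1. rewrite Rmult_assoc, Rinv_l by lra. lra.
Qed.

(** The bound of [difference_quotient_derivative], even weighted by [Im w], blows up at the real
    line. It serves only above a height [y]; below [y] the premise bounds the quotient and [H]
    separately, for every positive [t]. *)
Lemma difference_quotient_uniform :
  (forall eps, 0 < eps -> exists delta, 0 < delta /\
      forall w, upper_half_plane w -> Im w < delta -> Im w * Cmod (H w) < eps) ->
  forall eps, 0 < eps -> exists delta, 0 < delta /\
    forall t w, 0 < t < delta -> upper_half_plane w ->
      Im w * Cmod ((G (w - RtoC t)%C - G w) / RtoC t + H w) <= eps.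
Proof.
intros L eps He. destruct (L (eps / 2) ltac:(lra)) as [y [Hy Ly]].
assert (HM : 0 <= M).
{ eapply Rle_trans; [|apply (HH Ci)]; unfold upper_half_plane; simpl; [|lra].
  apply Rmult_le_pos; [lra|apply Cmod_ge_0]. }
(* For such [t], [4 * M * t <= eps * y], which is at most [eps * Im w] above height [y]; the added 1
   covers [M = 0]. *)
exists (eps * y / (4 * M + 1)); split.
{ apply Rdiv_lt_0_compat; [nra|lra]. }
intros t w Ht Hw. assert (Hw' : 0 < Im w) by exact Hw.
destruct (Rlt_le_dec (Im w) y) as [Lo|Hi].
- assert (E : Cmod (G (w - RtoC t)%C - G w) <= eps / 2 / Im w * t).
  { apply (horizontal_increment G H); [lra|]. intros s _.
    assert (U := upper_translate w s Hw). split; [auto|].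
    assert (B := Ly _ U). rewrite Im_translate in B.
    apply Rmult_le_reg_l with (Im w); [lra|].
    replace (Im w * (eps / 2 / Im w)) with (eps / 2) by (field; lra). lra. }
  assert (Nt := RtoC_neq_0 t ltac:(lra)).
  assert (E' : Im w * Cmod ((G (w - RtoC t)%C - G w) / RtoC t) <= eps / 2).
  { rewrite Cmod_div, Cmod_R, Rabs_pos_eq by (auto; lra).
    apply Rle_trans with (Im w * (eps / 2 / Im w * t / t)).
    - apply Rmult_le_compat_l; [lra|]. apply Rmult_le_compat_r; [left; apply Rinv_0_lt_compat; lra|exact E].
    - right. field. lra. }
  assert (T := Cmod_triangle ((G (w - RtoC t) - G w) / RtoC t) (H w)).
  apply (Rmult_le_compat_l (Im w)) in T; [|lra].
  specialize (Ly w Hw Lo). lra.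
- assert (E := difference_quotient_derivative w t Hw ltac:(lra)).
  apply (Rmult_le_compat_l (Im w)) in E; [|lra].
  eapply Rle_trans; [apply E|].
  replace (Im w * (4 * M / (Im w * Im w) * t)) with (4 * M * t / Im w) by (field; lra).
  apply Rmult_le_reg_r with (Im w); [lra|].
  unfold Rdiv at 1. rewrite Rmult_assoc, Rinv_l, Rmult_1_r by lra.
  apply Rle_trans with (eps * y); [|apply Rmult_le_compat_l; lra].
  apply Rle_trans with ((4 * M + 1) * (eps * y / (4 * M + 1))).
  + apply Rmult_le_compat; lra.
  + right; field; lra.
Qed.

End BlochDerivative.

(** * Real bounds extracted from the extended-real Bloch norm *)

Lemma bloch_seminorm_ub (f : C -> C) (w : C) :
  upper_half_plane w -> Rbar_le (Im w * Cmod (C_derive f w)) (bloch_seminorm f).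
Proof.
intros Hw. apply (proj1 (Lub_Rbar_correct _)). exists w; auto.
Qed.

Lemma bloch_seminorm_le (f : C -> C) (B : R) :
  (forall w, upper_half_plane w -> Im w * Cmod (C_derive f w) <= B) ->
  Rbar_le (bloch_seminorm f) B.
Proof.
intros H. apply (proj2 (Lub_Rbar_correct _)). intros y [w [Hw ->]]. apply H, Hw.
Qed.

Lemma bloch_bounded (f : C -> C) : bloch f ->
  exists M, forall w, upper_half_plane w -> Im w * Cmod (C_derive f w) <= M.
Proof.
intros [_ H]. destruct (bloch_seminorm f) as [M| |] eqn:E.
- exists M. intros w Hw. assert (B := bloch_seminorm_ub f w Hw). rewrite E in B. exact B.
- destruct H.
(* The value [m_infty] is impossible, since the supremum dominates a real number at any point of the
   half plane. *)
- exists 0. intros w Hw. assert (B := bloch_seminorm_ub f w Hw). rewrite E in B. destruct B.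
Qed.

Lemma bloch_norm_lt (f : C -> C) (eps : R) : Rbar_lt (bloch_norm f) eps ->
  Cmod (f Ci) < eps /\ forall w, upper_half_plane w -> Im w * Cmod (C_derive f w) <= eps.
Proof.
unfold bloch_norm. intros H.
assert (U : upper_half_plane Ci) by (unfold upper_half_plane; simpl; lra).
assert (B := fun w => bloch_seminorm_ub f w).
assert (P := Cmod_ge_0 (f Ci)).
destruct (bloch_seminorm f) as [M| |]; simpl in H, B.
(* The seminorm dominates its value at [Ci], hence is nonnegative, so each of the two summands is
   bounded by the norm. *)
- assert (B0 := B _ U). assert (Q := Cmod_ge_0 (C_derive f Ci)). simpl in B0.
  split; [lra|]. intros w Hw. specialize (B w Hw). lra.
- destruct H.
- destruct (B _ U).
Qed.

Lemma bloch_norm_le (f : C -> C) (a b : R) : Cmod (f Ci) <= a ->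
  (forall w, upper_half_plane w -> Im w * Cmod (C_derive f w) <= b) ->
  Rbar_le (bloch_norm f) (a + b).
Proof.
intros Ha Hb. unfold bloch_norm. apply bloch_seminorm_le in Hb.
change (Finite (a + b)) with (Rbar_plus a b). apply Rbar_plus_le_compat; auto.
Qed.

(** Carries membership between a generator value and the derivative of [g], in both directions,
    although they are related only on the half plane. *)
Lemma little_bloch_i_of_opp (f h : C -> C) : little_bloch_i f ->
  (forall w, upper_half_plane w -> h w = Copp (f w)) -> little_bloch_i h.
Proof.
intros [[[Ha Hb] Hl] Hi] E.
assert (D : forall w, upper_half_plane w -> cderiv h w (- (1) * C_derive f w)%C).
{ intros w Hw. apply (cderiv_ext_upper (fun z => - (1) * f z)%C); auto.
  - intros z Hz. rewrite E by auto. ring.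
  - apply cderiv_linear, cderiv_C_derive; auto. }
assert (DE : forall w, upper_half_plane w -> Cmod (C_derive h w) = Cmod (C_derive f w)).
{ intros w Hw. rewrite (is_C_derive_unique _ _ _ (D w Hw)), Cmod_mult, Cmod_m1. ring. }
destruct (bloch_bounded f (conj Ha Hb)) as [M HM].
repeat split.
- intros w Hw. eexists; apply D, Hw.
- apply Rbar_le_lt_trans with (Finite M); [|exact I].
  apply bloch_seminorm_le. intros w Hw. rewrite DE; auto.
- intros eps He. destruct (Hl eps He) as [d [Hd L]]. exists d; split; auto.
  intros w Hw B. rewrite DE; auto.
- rewrite E by (unfold upper_half_plane; simpl; lra). rewrite Hi. ring.
Qed.

(** * The generator of translations *)

Lemma cderiv_quotient (g h : C -> C) (t : R) (w l : C) : t <> 0 -> analytic g -> upper_half_plane w ->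
  cderiv h w l ->
  cderiv (fun w => (translation t g w - g w) / RtoC t - h w)%C w
    ((C_derive g (w - RtoC t) - C_derive g w) / RtoC t - l)%C.
Proof.
intros Ht Hg Hw Hh. apply cderiv_minus; auto.
apply (cderiv_ext_upper (fun w => / RtoC t * (translation t g w - g w))%C); auto.
- intros z _. unfold Cdiv. ring.
- replace ((C_derive g (w - RtoC t) - C_derive g w) / RtoC t)%C with
   (/ RtoC t * (C_derive g (w - RtoC t) - C_derive g w))%C by (unfold Cdiv; ring).
  apply cderiv_linear, cderiv_minus; [apply cderiv_translation|]; apply cderiv_C_derive; auto using upper_translate.
Qed.

(** Translation moves the argument by [- t], so the quotient tends to [- l]; this is the source of
    the sign of the generator. *)
Lemma difference_quotient_pointwise (g : C -> C) (w l : C) : cderiv g w l ->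
  forall eps, 0 < eps -> exists delta, 0 < delta /\ forall t, 0 < t < delta ->
    Cmod ((translation t g w - g w) / RtoC t + l) <= eps.
Proof.
rewrite cderiv_eps. intros H eps He. destruct (H eps He) as [d [Hd Hz]].
exists d; split; auto. intros t Ht. specialize (Hz (w - RtoC t)%C).
replace (w - RtoC t - w)%C with (- RtoC t)%C in Hz by ring.
rewrite Cmod_opp, Cmod_R, Rabs_pos_eq in Hz by lra. specialize (Hz ltac:(lra)).
assert (Nt := RtoC_neq_0 t ltac:(lra)).
unfold translation.
replace ((g (w - RtoC t) - g w) / RtoC t + l)%C with ((g (w - RtoC t) - g w - - RtoC t * l) / RtoC t)%C
  by (field; auto).
rewrite Cmod_div, Cmod_R, Rabs_pos_eq by (auto; lra).
apply Rmult_le_reg_r with t; [lra|]. unfold Rdiv. rewrite Rmult_assoc, Rinv_l by lra. lra.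
Qed.

Lemma generator_value (g h : C -> C) (w : C) : translation_generator g h -> upper_half_plane w ->
  h w = Copp (C_derive g w).
Proof.
intros [[[[Hg _] _] _] [[[[Hh _] _] _] HN]] Hw. assert (Hw' : 0 < Im w) by exact Hw.
assert (M1 := Rmin_l 1 (Im w)). assert (M2 := Rmin_r 1 (Im w)).
assert (M3 : 0 < Rmin 1 (Im w)) by (apply Rmin_glb_lt; lra).
set (m := Rmin _ _) in *.
(* Three errors add up to [eps * K]: the pointwise quotient at [w] and the value [D Ci] cost [eps]
   each, and passing from [Ci] to [w] costs [eps / m * Cmod (w - Ci)]. *)
set (K := 2 + Cmod (w - Ci) / m).
assert (HK : 0 < K).
{ unfold K. assert (0 <= Cmod (w - Ci) / m); [|lra].
  apply Rmult_le_pos; [apply Cmod_ge_0|left; apply Rinv_0_lt_compat, M3]. }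
assert (Z : (h w + C_derive g w)%C = 0%C).
{ apply Cmod_eq_0, Rle_antisym; [|apply Cmod_ge_0].
  apply le_epsilon. intros eps0 He0. rewrite Rplus_0_l.
  set (eps := eps0 / K). assert (He : 0 < eps) by (apply Rdiv_lt_0_compat; lra).
  destruct (HN eps He) as [d1 Hd1].
  destruct (difference_quotient_pointwise g w _ (cderiv_C_derive g w Hg Hw) eps He) as [d2 [Hd2 Q]].
  assert (N1 := Rmin_l d1 d2). assert (N2 := Rmin_r d1 d2).
  assert (N3 : 0 < Rmin d1 d2) by (apply Rmin_glb_lt; [apply cond_pos|lra]).
  set (t := Rmin d1 d2 / 2). assert (Ht : 0 < t < d1 /\ t < d2) by (unfold t; lra).
  specialize (Q t ltac:(lra)).
  specialize (Hd1 t).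
  assert (Bt : ball 0 d1 t) by (change (Rabs (t - 0) < d1); rewrite Rminus_0_r, Rabs_pos_eq; lra).
  specialize (Hd1 Bt ltac:(lra)). clear Bt.
  apply bloch_norm_lt in Hd1. destruct Hd1 as [Di Dw].
  set (D := fun w => ((translation t g w - g w) / RtoC t - h w)%C) in *.
  change (Cmod (D Ci) < eps) in Di.
  assert (DI : Cmod (D w - D Ci) <= eps / m * Cmod (w - Ci)).
  (* Height is affine on the segment from [Ci] to [w], so it never falls below [m], and the Bloch
     bound gives a derivative of modulus at most [eps / m]. *)
  { apply (mean_value_inequality D (C_derive D)). intros s Hs.
    set (z := (Ci + RtoC s * (w - Ci))%C).
    assert (Hz : m <= Im z).
    { replace (Im z) with ((1 - s) * 1 + s * Im w) by (unfold z; destruct w; simpl; ring). nra. }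
    assert (Uz : upper_half_plane z) by (unfold upper_half_plane; lra).
    split.
    - apply C_derive_correct; [exact z|]. eexists.
      apply (cderiv_quotient g h t z); auto; [lra|]. apply cderiv_C_derive; auto.
    - specialize (Dw z Uz). apply Rmult_le_reg_l with m; [lra|].
      replace (m * (eps / m)) with eps by (field; lra).
      eapply Rle_trans; [|apply Dw]. apply Rmult_le_compat_r; [apply Cmod_ge_0|exact Hz]. }
  replace (h w + C_derive g w)%C with
   (((translation t g w - g w) / RtoC t + C_derive g w) - ((D w - D Ci) + D Ci))%C by (unfold D; ring).
  eapply Rle_trans; [apply Cmod_minus_triangle|].
  assert (T := Cmod_triangle (D w - D Ci) (D Ci)).
  replace eps0 with (eps * K) by (unfold eps; field; lra).
  replace (eps * K) with (eps + eps / m * Cmod (w - Ci) + eps) by (unfold K; field; lra).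
  lra. }
replace (h w) with ((h w + C_derive g w) - C_derive g w)%C by ring. rewrite Z. ring.
Qed.

(** The two summands of the Bloch norm are treated separately: the value at [Ci] by
    differentiability of [g] there, the seminorm by [difference_quotient_uniform] with [G] and [H]
    the first two derivatives of [g]. *)
Lemma generator_of_derivative (g h : C -> C) : little_bloch_i g -> little_bloch_i (C_derive g) ->
  (forall w, upper_half_plane w -> h w = Copp (C_derive g w)) -> translation_generator g h.
Proof.
intros Hg HG Hh. split; [exact Hg|]. split; [exact (little_bloch_i_of_opp _ _ HG Hh)|].
destruct Hg as [[[Ag _] _] _]. destruct HG as [[[AG BG] LG] _].
destruct (bloch_bounded _ (conj AG BG)) as [M HM].
assert (Ui : upper_half_plane Ci) by (unfold upper_half_plane; simpl; lra).
intros eps He.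
destruct (difference_quotient_uniform g (C_derive g) (C_derive (C_derive g)) M
  (fun z => cderiv_C_derive g z Ag) (fun z => cderiv_C_derive _ z AG) HM LG (eps / 4) ltac:(lra)) as [d1 [Hd1 U]].
destruct (difference_quotient_pointwise g Ci _ (cderiv_C_derive g Ci Ag Ui) (eps / 4) ltac:(lra)) as [d2 [Hd2 Q]].
assert (N1 := Rmin_l d1 d2). assert (N2 := Rmin_r d1 d2).
assert (N3 : 0 < Rmin d1 d2) by (apply Rmin_glb_lt; lra).
exists (mkposreal _ N3).
change (forall t : R, Rabs (t - 0) < Rmin d1 d2 -> 0 < t ->
  Rbar_lt (bloch_norm (fun w => (translation t g w - g w) / RtoC t - h w)%C) eps).
intros t Bt Ht. rewrite Rminus_0_r, Rabs_pos_eq in Bt by lra.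
(* Both summands are bounded non-strictly by a quarter of [eps], which leaves room for the strict
   inequality. *)
apply Rbar_le_lt_trans with (Finite (eps / 4 + eps / 4)); [|simpl; lra].
apply bloch_norm_le.
- rewrite Hh by exact Ui.
  replace ((translation t g Ci - g Ci) / RtoC t - - C_derive g Ci)%C with
   ((translation t g Ci - g Ci) / RtoC t + C_derive g Ci)%C by ring.
  apply Q; lra.
- intros w Hw.
  assert (Dh : cderiv h w (- (1) * C_derive (C_derive g) w)%C).
  { apply (cderiv_ext_upper (fun z => - (1) * C_derive g z)%C); auto.
    - intros z Hz. rewrite Hh by auto. ring.
    - apply cderiv_linear, cderiv_C_derive; auto. }
  rewrite (is_C_derive_unique (fun w => (translation t g w - g w) / RtoC t - h w)%C w _
    (cderiv_quotient g h t w _ (Rgt_not_eq _ _ Ht) Ag Hw Dh)).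
  replace ((C_derive g (w - RtoC t) - C_derive g w) / RtoC t - - (1) * C_derive (C_derive g) w)%C
    with ((C_derive g (w - RtoC t) - C_derive g w) / RtoC t + C_derive (C_derive g) w)%C by ring.
  apply U; [lra|exact Hw].
Qed.

Theorem theorem3p7 :
  (forall g : C -> C,
     translation_generator_domain g <->
     little_bloch_i g /\ little_bloch_i (C_derive g)) /\
  (forall g h : C -> C,
     translation_generator_domain g ->
     (translation_generator g h <->
      forall w : C, upper_half_plane w -> h w = Copp (C_derive g w))).
Proof.
assert (Dom : forall g, translation_generator_domain g <-> little_bloch_i g /\ little_bloch_i (C_derive g)).
{ intros g. split.
  - intros [h Hh]. split; [exact (proj1 Hh)|].
    (* The value [h] lies in the space by definition of the generator, so [g'], being its opposite,
       does too; in particular [g'] vanishes at [Ci]. *)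
    apply (little_bloch_i_of_opp h); [exact (proj1 (proj2 Hh))|].
    intros w Hw. rewrite (generator_value g h w Hh Hw). ring.
  - intros [Hg HG]. exists (fun w => - C_derive g w)%C.
    apply generator_of_derivative; auto. }
split; [exact Dom|].
intros g h Hg. apply Dom in Hg. destruct Hg as [Hg HG]. split.
- intros Hh w Hw. exact (generator_value g h w Hh Hw).
- intros Hh. apply generator_of_derivative; auto.
Qed.
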